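(* Let $\mathbb C^2_*=\mathbb C^2\setminus\{0\}$ and let $\phi\in\mathrm{Aut}(\mathbb P^1)$ be $\phi(v)=\frac{v+1/2}{1+v/2}$. Let $\mathbb Z$ act on $\tilde B=\mathbb C^2_*\times\mathbb P^1$ by $n\cdot(z,v)=(2^nz,\phi^n(v))$, let $B=\tilde B/\mathbb Z$ with quotient map $\tilde\pi$ (a flat $\mathbb P^1$-bundle over the Hopf surface $H=\mathbb C^2_*/\{z\mapsto 2^nz\}$), and let $\Omega=\tilde\pi(\mathbb C^2_*\times\Delta)$, where $\Delta$ is the open unit disc. Then the closure $\overline\Omega=\Omega\cup\tilde\pi(\mathbb C^2_*\times S^1)$ of $\Omega$ in $B$ has no pseudoconvex neighborhood basis; more precisely, there is no decreasing sequence of pseudoconvex domains $\Omega_n$ in $B$ with $\bigcap_n\Omega_n=\overline\Omega$.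
   Context: $S^1$ is the unit circle in $\mathbb C$. A pseudoconvex neighborhood basis of a set $K$ is a family of pseudoconvex open neighborhoods of $K$ such that every open neighborhood of $K$ contains one of them. *)

(* Defs.v *)
From HB Require Import structures.
From mathcomp Require Import all_boot all_order all_algebra.
From mathcomp Require Import all_classical all_reals all_analysis.
From mathcomp Require Import complex.
Import Order.TTheory GRing.Theory Num.Theory.
Import numFieldTopology.Exports numFieldNormedType.Exports.

Set Implicit Arguments.
Unset Strict Implicit.
Unset Printing Implicit Defensive.

Local Open Scope classical_set_scope.
Local Open Scope ring_scope.

HB.instance Definition _ (R : realType) :=
  PseudoPointedMetric.copy R[i] (R[i] : numFieldType)^o.

Section Defs.
Variable R : realType.

Definition CC := R[i].
Definition C3 := (CC * CC * CC)%type.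

Definition c3_line (a b : C3) (zeta : CC) : C3 :=
  (a.1.1 + zeta * b.1.1, a.1.2 + zeta * b.1.2, a.2 + zeta * b.2).

Definition expi (t : R) : CC := (cos t +i* sin t)%C.

(* u is plurisubharmonic on G (for continuous real-valued u): sub-mean-value
   property on every closed complex disc {a + zeta b : |zeta| <= 1} in G. *)
Definition psh (G : set C3) (u : C3 -> R) : Prop :=
  forall a b : C3, (forall zeta : CC, `|zeta| <= 1 -> G (c3_line a b zeta)) ->
  (((2 * pi) * u a)%:E <=
     \int[lebesgue_measure]_(t in `[0%R, (2 * pi)%R]) (u (c3_line a b (expi t)))%:E)%E.

Definition pseudoconvex_C3 (G : set C3) : Prop :=
  open G /\
  exists u : C3 -> R, {within G, continuous u} /\ psh G u /\
    forall c : R, compact [set x | G x /\ u x <= c].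

(* \tilde B = C^2_* x P^1 ; P^1 = option CC, None being the point at infinity *)
Record Bt := MkBt { bz1 : CC; bz2 : CC; bv : option CC;
                    bnz : (bz1 != 0) || (bz2 != 0) }.

Definition chart (k : bool) (p : Bt) : option C3 :=
  if k then
    match bv p with Some v => Some (bz1 p, bz2 p, v) | None => None end
  else
    match bv p with
    | None => Some (bz1 p, bz2 p, 0)
    | Some v => if v == 0 then None else Some (bz1 p, bz2 p, v^-1)
    end.

Definition chart_img (k : bool) (S : set Bt) : set C3 :=
  [set x | exists2 p, S p & chart k p = Some x].

Definition Bt_open (S : set Bt) : Prop := forall k, open (chart_img k S).

Definition Bt_pseudoconvex (D : set Bt) : Prop :=
  Bt_open D /\
  forall p : Bt, exists k (x : C3), chart k p = Some x /\
    exists V : set C3, [/\ open V, V x, V `<=` chart_img k setT &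
                          pseudoconvex_C3 (V `&` chart_img k D)].

Definition phi (w : option CC) : option CC :=
  match w with
  | None => Some 2
  | Some v => if 1 + v / 2 == 0 then None else Some ((v + 2^-1) / (1 + v / 2))
  end.

Definition phi_inv (w : option CC) : option CC :=
  match w with
  | None => Some (-2)
  | Some v => if 1 - v / 2 == 0 then None else Some ((v - 2^-1) / (1 - v / 2))
  end.

Definition phin (n : int) (w : option CC) : option CC :=
  match n with
  | Posz m => iter m phi w
  | Negz m => iter m.+1 phi_inv w
  end.

Definition orbitZ (p : Bt) : set Bt :=
  [set q | exists n : int, [/\ bz1 q = (2 : CC) ^ n * bz1 p,
                               bz2 q = (2 : CC) ^ n * bz2 p &
                               bv q = phin n (bv p)]].

Definition B := {O : set Bt | exists p, O = orbitZ p}.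

Definition tpi (p : Bt) : B := exist _ (orbitZ p) (ex_intro _ p erefl).

Definition B_open (U : set B) : Prop := Bt_open (tpi @^-1` U).

Definition B_closure (A : set B) : set B :=
  [set b | forall U, B_open U -> U b -> exists2 c, U c & A c].

Definition B_connected (A : set B) : Prop :=
  forall U V : set B, B_open U -> B_open V -> A `<=` U `|` V ->
    (exists2 a, A a & U a) -> (exists2 a, A a & V a) ->
    exists a, [/\ A a, U a & V a].

Definition B_domain (A : set B) : Prop := B_open A /\ B_connected A.

(* complex structure of B is induced by the covering tpi (a local
   biholomorphism), and pseudoconvexity is local *)
Definition B_pseudoconvex (A : set B) : Prop := Bt_pseudoconvex (tpi @^-1` A).

Definition Omega : set B :=
  tpi @` [set p | exists2 v, bv p = Some v & `|v| < 1].

Definition circle_part : set B :=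
  tpi @` [set p | exists2 v, bv p = Some v & `|v| = 1].

End Defs.

(* Main.v *)
Require Import Defs.
From HB Require Import structures.
From mathcomp Require Import all_boot all_order all_algebra.
From mathcomp Require Import all_classical all_reals all_analysis.
From mathcomp Require Import complex ring lra.
Import Order.TTheory GRing.Theory Num.Theory.
Import numFieldTopology.Exports numFieldNormedType.Exports.

Set Implicit Arguments.
Unset Strict Implicit.
Unset Printing Implicit Defensive.

(* Let [D] be the preimage in [C^2_* x P^1] of a pseudoconvex neighborhood of the
   closure: it is open, invariant, and contains [C^2_* x {|v| <= 1}]. By
   compactness of the shell [1 <= |z| <= 2], [D] contains shell x [{v}] for every
   [v] near the repelling fixed point [-1] of [phi]. Hartogs' phenomenon fills
   the shell: if the slice over [v] missed some [z] with [0 < |z| < 1], take such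
   a [z] of maximal norm; the complex tangent line of the sphere at [z] and its
   outward translates are contained in [D] away from [z], and the maximum
   principle on small discs in these lines contradicts the existence of a local
   plurisubharmonic exhaustion function at [z]. Now if [(z, v)] has [v] outside
   the closed disc, then [phi^-n v -> -1] and [2^-n z -> 0], so
   [(-n).(z, v)] lies in [D], and by invariance so does [(z, v)]. Hence every
   pseudoconvex neighborhood of the closure is all of [B]. *)

Local Open Scope classical_set_scope.

(** * Product topologies and an upper bound for integrals *)

Section Generalities.
Local Open Scope ring_scope.

Lemma hausdorff_prod (T U : topologicalType) :
  hausdorff_space T -> hausdorff_space U -> hausdorff_space (T * U)%type.
Proof.
move=> hT hU [p1 p2] [q1 q2] pq.
congr pair.
- apply: hT => A B Ap Bq.
  have [|x [Ax Bx]] := pq (fst @^-1` A) (fst @^-1` B) (cvg_fst Ap).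
    exact: (cvg_fst Bq).
  by exists x.1.
- apply: hU => A B Ap Bq.
  have [|x [Ax Bx]] := pq (snd @^-1` A) (snd @^-1` B) (cvg_snd Ap).
    exact: (cvg_snd Bq).
  by exists x.2.
Qed.

Lemma continuous_pair (T U V : topologicalType) (f : T -> U) (g : T -> V) :
  continuous f -> continuous g -> continuous (fun x => (f x, g x)).
Proof. by move=> cf cg x; apply: cvg_pair; [exact: cf | exact: cg]. Qed.

Lemma continuous_fst (T U : topologicalType) : continuous (fst : T * U -> T).
Proof. by move=> x; exact: cvg_fst. Qed.

Lemma continuous_snd (T U : topologicalType) : continuous (snd : T * U -> U).
Proof. by move=> x; exact: cvg_snd. Qed.

Lemma open_preimage (T U : topologicalType) (f : T -> U) (A : set U) :
  continuous f -> open A -> open (f @^-1` A).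
Proof. by move=> cf oA; apply: open_comp => // x _; exact: cf. Qed.

(* No measurability is needed: the integral is at most that of the positive part,
   a supremum over simple functions, which is monotone for arbitrary functions. *)
Lemma integral_itv_le_cst (R : realType) (a b M : R) (f : R -> R) :
  a <= b -> 0 <= M -> (forall t, t \in `[a, b] -> f t <= M) ->
  (\int[lebesgue_measure]_(t in `[a, b]) (f t)%:E <= (M * (b - a))%:E)%E.
Proof.
move=> ab M0 fM.
have -> : ((M * (b - a))%:E = \int[lebesgue_measure]_(t in `[a, b]) (cst M%:E t))%E.
  rewrite integral_cst//= lebesgue_measure_itv/= lte_fin.
  by case: ltP => // ba; have -> : b = a by [lra]; rewrite subrr mulr0 mule0.
rewrite integralE.
apply: (@le_trans _ _ (\int[lebesgue_measure]_(t in `[a, b]) ((fun t => (f t)%:E)^\+ t))%E).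
  by rewrite geeDl// oppe_le0 integral_ge0.
rewrite !ge0_integralE//.
apply: le_ereal_sup => _ [h hf <-]; exists h => // x.
apply: le_trans (hf x) _; rewrite /patch; case: ifPn => // /set_mem xab.
by rewrite funeposE/= ge_max !lee_fin fM.
Qed.

End Generalities.

(** * The squared modulus and the topology of the complex plane *)

Section ComplexTopology.
Variable R : realType.
Local Open Scope ring_scope.
Local Notation C := (CC R).

(** Real-valued, unlike the norm of [R[i]], and polynomial in the coordinates, so that estimates
    reduce to real polynomial inequalities. *)
Definition normsq (x : C) : R := complex.Re x ^+ 2 + complex.Im x ^+ 2.

Lemma normsq_ge0 x : 0 <= normsq x.
Proof. by rewrite addr_ge0 ?sqr_ge0. Qed.

Lemma normsq_eq0 x : (normsq x == 0) = (x == 0).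
Proof. by rewrite paddr_eq0 ?sqr_ge0// !sqrf_eq0 eq_complex. Qed.

Lemma normsqM x y : normsq (x * y) = normsq x * normsq y.
Proof. by case: x y => [a b] [c d]; rewrite /normsq/=; ring. Qed.

Lemma normsq_real (r : R) : normsq (r%:C%C : C) = r ^+ 2.
Proof. by rewrite /normsq/= expr0n addr0. Qed.

Lemma normsq_conj (x : C) : normsq (conjc x) = normsq x.
Proof. by case: x => a b; rewrite /normsq/= sqrrN. Qed.

Lemma normsqN (x : C) : normsq (- x) = normsq x.
Proof. by case: x => a b; rewrite /normsq/= !sqrrN. Qed.

Lemma normsq_div (x y : C) : y != 0 -> normsq (x / y) = normsq x / normsq y.
Proof.
move=> y0; have ny0 : normsq y != 0 by rewrite normsq_eq0.
by apply: (mulIf ny0); rewrite -normsqM !divfK.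
Qed.

Lemma normsqV (c : C) : c != 0 -> normsq c^-1 = (normsq c)^-1.
Proof.
by move=> c0; rewrite -[c^-1]div1r normsq_div// normsq_real expr1n div1r.
Qed.

Lemma normsq_add_le (x y : C) : normsq (x + y) <= 2 * (normsq x + normsq y).
Proof.
case: x y => [a b] [c d]; rewrite /normsq/=.
by have := sqr_ge0 (a - c); have := sqr_ge0 (b - d); nra.
Qed.

Lemma normsqE x : (normsq x)%:C%C = `|x| ^+ 2.
Proof. exact: add_Re2_Im2. Qed.

Lemma normc_lt x (e : R) : 0 <= e -> (`|x| < e%:C%C) = (normsq x < e ^+ 2).
Proof.
move=> e0; rewrite -(@ltr_pXn2r _ 2)// ?nnegrE ?ler0c//.
by rewrite -normsqE -rmorphXn/= ltcR.
Qed.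

Lemma normc_le x (e : R) : 0 <= e -> (`|x| <= e%:C%C) = (normsq x <= e ^+ 2).
Proof.
move=> e0; rewrite -(@ler_pXn2r _ 2)// ?nnegrE ?ler0c//.
by rewrite -normsqE -rmorphXn/= lecR.
Qed.

Lemma normc_lt1 x : (`|x| < 1) = (normsq x < 1).
Proof. by rewrite (normc_lt x ler01) expr1n. Qed.

Lemma normc_le1 x : (`|x| <= 1) = (normsq x <= 1).
Proof. by rewrite (normc_le x ler01) expr1n. Qed.

Lemma normc_eq1 x : (`|x| == 1) = (normsq x == 1).
Proof.
by rewrite -(@eqrXn2 _ 2 `|x| 1)// expr1n -normsqE -(inj_eq (@complexI R)).
Qed.

(** Balls of [R[i]] have a complex radius; positivity makes it real, which allows a real bound on
    [normsq] instead. *)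
Lemma nbhs_CP (x : C) (A : set C) :
  nbhs x A <-> exists2 e : R, 0 < e & forall y, normsq (y - x) < e -> A y.
Proof.
split=> [/nbhs_ballP[e e0 xA]|[e e0 xA]].
  have eE : e = (complex.Re e)%:C%C by rewrite RRe_real ?gtr0_real.
  move: e0; rewrite /= eE ltcR => e0.
  exists (complex.Re e ^+ 2); first exact: exprn_gt0.
  move=> y xy; apply: xA; rewrite /ball/= distrC eE normc_lt ?ltW//.
apply/nbhs_ballP; exists (Num.sqrt e)%:C%C; first by rewrite /= ltcR sqrtr_gt0.
move=> y; rewrite /ball/= distrC normc_lt ?sqrtr_ge0// sqr_sqrtr ?ltW//.
exact: xA.
Qed.

Lemma continuous_Re : continuous (@complex.Re R : C -> R).
Proof.
move=> x A /nbhs_ballP[e /= e0 eA].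
apply/nbhs_CP; exists (e ^+ 2); first exact: exprn_gt0.
move=> y yx; apply: eA; rewrite /ball/= -(@ltr_pXn2r _ 2) ?nnegrE ?normr_ge0 ?ltW//.
apply: le_lt_trans yx; rewrite /normsq real_normK ?num_real//.
by case: x y => [a b] [c d] /=; have := sqr_ge0 (d - b); nra.
Qed.

Lemma continuous_Im : continuous (@complex.Im R : C -> R).
Proof.
move=> x A /nbhs_ballP[e /= e0 eA].
apply/nbhs_CP; exists (e ^+ 2); first exact: exprn_gt0.
move=> y yx; apply: eA; rewrite /ball/= -(@ltr_pXn2r _ 2) ?nnegrE ?normr_ge0 ?ltW//.
apply: le_lt_trans yx; rewrite /normsq real_normK ?num_real//.
by case: x y => [a b] [c d] /=; have := sqr_ge0 (c - a); nra.
Qed.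

Lemma continuous_Complex : continuous (fun x : R * R => (x.1 +i* x.2)%C : C).
Proof.
move=> [a b] A /nbhs_CP[e e0 eA].
have he0 : 0 < Num.sqrt (e / 2) by rewrite sqrtr_gt0 divr_gt0.
exists (ball a (Num.sqrt (e / 2)), ball b (Num.sqrt (e / 2))).
  by split; exact: nbhsx_ballx (Num.sqrt (e / 2)) he0.
have H (x y : R) : ball x (Num.sqrt (e / 2)) y -> (y - x) ^+ 2 < e / 2.
  rewrite /ball/= distrC => h.
  rewrite -[X in _ < X]sqr_sqrtr ?divr_ge0 ?ltW// -real_normK ?num_real//.
  by rewrite ltr_pXn2r ?nnegrE ?normr_ge0 ?sqrtr_ge0.
move=> [c d] [/= /H ac /H bd]; apply: eA; rewrite /normsq/=; lra.
Qed.

Lemma continuous_addC : continuous (fun x : C * C => x.1 + x.2).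
Proof. exact: (@add_continuous (R[i] : numFieldType)). Qed.

Lemma continuous_mulC : continuous (fun x : C * C => x.1 * x.2).
Proof. exact: (@mul_continuous (R[i] : numFieldType)). Qed.

Lemma hausdorff_C : hausdorff_space C.
Proof. exact: (@norm_hausdorff _ (R[i] : numFieldType)). Qed.

Lemma continuous_normsq : continuous normsq.
Proof.
have sq (f : C -> R) : continuous f -> continuous (fun x => f x ^+ 2).
  move=> cf x; exact: (continuous_comp (cf x) (@exprn_continuous _ 2 (f x))).
move=> x; exact: (cvgD (sq _ continuous_Re x) (sq _ continuous_Im x)).
Qed.

End ComplexTopology.

(** * The continuity principle for families of analytic discs *)

Section ContinuityPrinciple.
Variable R : realType.
Local Open Scope ring_scope.
Local Notation C := (CC R).

Lemma continuous_addC_fun (T : topologicalType) (f g : T -> C) :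
  continuous f -> continuous g -> continuous (fun x => f x + g x).
Proof.
move=> cf cg x.
exact: (@continuous_comp _ _ _ (fun x => (f x, g x)) (fun p => p.1 + p.2) x
  (continuous_pair cf cg (x := x)) (@continuous_addC R _)).
Qed.

Lemma continuous_mulC_fun (T : topologicalType) (f g : T -> C) :
  continuous f -> continuous g -> continuous (fun x => f x * g x).
Proof.
move=> cf cg x.
exact: (@continuous_comp _ _ _ (fun x => (f x, g x)) (fun p => p.1 * p.2) x
  (continuous_pair cf cg (x := x)) (@continuous_mulC R _)).
Qed.

Lemma continuous_Complex_fun (T : topologicalType) (f g : T -> R) :
  continuous f -> continuous g -> continuous (fun x => (f x +i* g x)%C : C).
Proof.
move=> cf cg x.
exact: (@continuous_comp _ _ _ (fun x => (f x, g x)) (fun p => (p.1 +i* p.2)%C : C) x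
  (continuous_pair cf cg (x := x)) (@continuous_Complex R _)).
Qed.

(** Continuity is joint in the shift [st.1] and the angle [st.2], as the compactness argument over
    all angles requires. *)
Lemma continuous_disc_family (x d b : C3 R) :
  continuous (fun st : R * R =>
    c3_line (c3_line x d (st.1)%:C%C) b (expi st.2)).
Proof.
have c1 : continuous (fun st : R * R => (st.1)%:C%C : C).
  by apply: continuous_Complex_fun => st; [exact: cvg_fst | exact: cvg_cst].
have c2 : continuous (fun st : R * R => expi st.2).
  apply: continuous_Complex_fun => st.
  - by apply: continuous_comp; [exact: cvg_snd | exact: continuous_cos].
  - by apply: continuous_comp; [exact: cvg_snd | exact: continuous_sin].
have c (u v w : C) : continuous (fun st : R * R =>
    (u + (st.1)%:C%C * v) + expi st.2 * w).
  have cst (y : C) : continuous (fun _ : R * R => y) by exact: cst_continuous.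
  have c1v := continuous_mulC_fun c1 (cst v).
  exact: (continuous_addC_fun (continuous_addC_fun (cst u) c1v)
    (continuous_mulC_fun c2 (cst w))).
apply: continuous_pair; last exact: c.
by apply: continuous_pair; exact: c.
Qed.

Lemma c3_line0 (a b : C3 R) : c3_line a b 0 = a.
Proof. by case: a => [[? ?] ?]; rewrite /c3_line/= !mul0r !addr0. Qed.

Lemma hausdorff_C3 : hausdorff_space (C3 R).
Proof.
apply: hausdorff_prod; last exact: hausdorff_C.
by apply: hausdorff_prod; exact: hausdorff_C.
Qed.

(** Near the limit circle [u] is bounded, so the sub-mean-value property bounds [u] at the centres
    of the discs. The centres thus stay in a compact sublevel set, which contains their limit
    [x]. *)
Lemma pseudoconvex_continuity_principle (G : set (C3 R)) (x d b : C3 R) :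
  pseudoconvex_C3 G ->
  (forall s : R, 0 < s <= 1 -> forall zeta : C, `|zeta| <= 1 ->
    G (c3_line (c3_line x d s%:C%C) b zeta)) ->
  (forall t, G (c3_line x b (expi t))) ->
  G x.
Proof.
move=> [oG [u [cu [pu ku]]]] Gdisc Gcirc.
rewrite continuous_open_subspace// in cu.
have idc : continuous (id : R -> R) by move=> ? ?; exact: id.
pose gam (st : R * R) := c3_line (c3_line x d (st.1)%:C%C) b (expi st.2).
have cgam : continuous gam := @continuous_disc_family x d b.
have gam0 t : gam (0, t) = c3_line x b (expi t) by rewrite /gam c3_line0.
have cug t : {for (0, t), continuous (u \o gam)}.
  by apply: continuous_comp; [exact: cgam | apply: cu; rewrite inE gam0].
have pi20 : 0 <= 2 * pi :> R by rewrite mulr_ge0// pi_ge0.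
have [|tm _ um] := @EVT_max R (fun t => u (gam (0, t))) 0 (2 * pi) pi20.
  apply: continuous_subspaceT => t.
  apply: (@continuous_comp _ _ _ (fun t => (0 : R, t)) (u \o gam)); last exact: cug.
  exact: (@continuous_pair R R R (cst 0) id (@cst_continuous _ _ 0) idc).
set M0 := u (gam (0, tm)) in um.
(* Tube argument over the compact interval of angles: one range of [s] works for every [t]. *)
have unif : \forall s \near (0 : R), `[0, 2 * pi] `<=` [set t | u (gam (s, t)) < M0 + 1].
  have nc := iffLR (compact_near_coveringP _) (@segment_compact R 0 (2 * pi)).
  apply: (nc R (nbhs (0 : R)) (fun s t => u (gam (s, t)) < M0 + 1)) => t tI.
  have /(cug t) : nbhs (u (gam (0, t))) [set y | y < M0 + 1].
    apply: open_nbhs_nbhs; split; first exact: open_lt.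
    by apply: le_lt_trans (um t tI) _; rewrite ltrDl.
  move=> [[A B]] [/= A0 Bt] AB; exists (B, A) => //.
  by move=> [t' s] [Bt' As]; exact: (AB (s, t')).
have unif' : \forall s \near 0^'+, `[0, 2 * pi] `<=` [set t | u (gam (s, t)) < M0 + 1].
  by apply: filterS unif => s + _.
(* The maximum with 0 meets the sign condition of [integral_itv_le_cst]. *)
pose M := Num.max (M0 + 1) 0.
have closedM : closed [set y | G y /\ u y <= M].
  by apply: compact_closed; [exact: hausdorff_C3 | exact: ku].
suff : [set y | G y /\ u y <= M] x by case.
(* The limit is taken from the right, since the full discs are in [G] only for [s > 0]. *)
apply: (@closed_cvg _ _ (0^'+ : set_system R) _ (fun s => c3_line x d s%:C%C) _ closedM).
  near=> s.
  have s01 : 0 < s <= 1.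
    by apply/andP; split; near: s; [exact: nbhs_right_gt | exact: nbhs_right_le].
  split.
    have := Gdisc s s01 0; rewrite c3_line0; apply; by rewrite normr0 ler01.
  have ubd t : t \in `[0, 2 * pi] -> u (gam (s, t)) <= M.
    move=> tI; rewrite le_max; apply/orP; left; apply: ltW.
    by move: t tI; near: s; apply: filterS unif' => s; exact.
  have M_ge0 : 0 <= M by rewrite le_max lexx orbT.
  have := le_trans (pu _ _ (Gdisc s s01)) (integral_itv_le_cst pi20 M_ge0 ubd).
  rewrite lee_fin subr0 mulrC ler_pM2r//; by rewrite mulr_gt0// pi_gt0.
apply: cvg_at_right_filter.
(* With disc direction 0 the family of circles collapses to the path of centres, whose continuity
   follows. *)
have line1 (a : C3 R) z : c3_line a (0, 0, 0) z = a.
  by case: a => [[? ?] ?]; rewrite /c3_line/= !mulr0 !addr0.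
have cl : continuous (fun s : R => c3_line x d s%:C%C).
  have -> : (fun s : R => c3_line x d s%:C%C) =
      (fun st : R * R => c3_line (c3_line x d (st.1)%:C%C) (0, 0, 0) (expi st.2))
      \o (fun s => (s, 0)).
    by apply/funext => s; rewrite /= line1.
  move=> s; apply: continuous_comp; last exact: continuous_disc_family.
  exact: (@continuous_pair R R R id (cst 0) idc (@cst_continuous _ _ 0)).
by rewrite -[X in _ --> X](c3_line0 x d); exact: cl.
Unshelve. all: by end_near.
Qed.

End ContinuityPrinciple.

(** * Filling a spherical shell in a slice *)

Section HartogsShell.
Variable R : realType.
Local Open Scope ring_scope.
Local Notation C := (CC R).

Definition normsq2 (z : C * C) : R := normsq z.1 + normsq z.2.

Lemma normsq2_gt0 (z1 z2 : C) : (0 < normsq2 (z1, z2)) = (z1 != 0) || (z2 != 0).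
Proof.
rewrite lt_def addr_ge0 ?normsq_ge0// andbT paddr_eq0 ?normsq_ge0//.
by rewrite !normsq_eq0 negb_and.
Qed.

Lemma continuous_normsq2 : continuous normsq2.
Proof.
move=> z; apply: cvgD.
- by apply: continuous_comp; [exact: cvg_fst | exact: continuous_normsq].
- by apply: continuous_comp; [exact: cvg_snd | exact: continuous_normsq].
Qed.

Lemma closed_normsq2_le (r : R) : closed [set z | normsq2 z <= r].
Proof. exact: (closed_comp (in1W continuous_normsq2) (@closed_le R r)). Qed.

Lemma closed_normsq2_ge (r : R) : closed [set z | r <= normsq2 z].
Proof. exact: (closed_comp (in1W continuous_normsq2) (@closed_ge R r)). Qed.

Lemma compact_normsq2_le (r : R) : compact [set z | normsq2 z <= r].
Proof.
(* [x^2 <= r] forces [|x| <= 1 + |r|], so all four real coordinates lie in [I]. *)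
pose I : set R := `[- (1 + `|r|), 1 + `|r|]%classic.
pose K : set C := (fun x : R * R => (x.1 +i* x.2)%C : C) @` (I `*` I).
have cK : compact K.
  apply: continuous_compact.
    by apply: continuous_subspaceT; exact: continuous_Complex.
  by apply: compact_setX; exact: segment_compact.
apply: (subclosed_compact (@closed_normsq2_le r) (compact_setX cK cK)).
have sqI (x y : R) : x ^+ 2 + y <= r -> 0 <= y -> I x.
  move=> xr y0; rewrite /I/= in_itv/=; have := ler_norm r.
  by move=> rr; apply/andP; split; nra.
move=> [[a b] [c d]]; rewrite /normsq2/normsq/= => abcd; split.
- exists (a, b) => //; split; rewrite /=.
  + by apply: (sqI _ (b ^+ 2 + c ^+ 2 + d ^+ 2));
      [lra | rewrite !addr_ge0 ?sqr_ge0].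
  + by apply: (sqI _ (a ^+ 2 + c ^+ 2 + d ^+ 2));
      [lra | rewrite !addr_ge0 ?sqr_ge0].
- exists (c, d) => //; split; rewrite /=.
  + by apply: (sqI _ (a ^+ 2 + b ^+ 2 + d ^+ 2));
      [lra | rewrite !addr_ge0 ?sqr_ge0].
  + by apply: (sqI _ (a ^+ 2 + b ^+ 2 + c ^+ 2));
      [lra | rewrite !addr_ge0 ?sqr_ge0].
Qed.

Lemma nbhs_C3P (x : C3 R) (A : set (C3 R)) : nbhs x A ->
  exists2 e : R, 0 < e & forall y : C3 R, normsq (y.1.1 - x.1.1) < e ->
    normsq (y.1.2 - x.1.2) < e -> normsq (y.2 - x.2) < e -> A y.
Proof.
case: x => [[x1 x2] x3] [[A12 A3]] [/= [[A1 A2] [/= n1 n2] s12] n3] s.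
have [e1 e10 h1] := iffLR (@nbhs_CP R _ _) n1.
have [e2 e20 h2] := iffLR (@nbhs_CP R _ _) n2.
have [e3 e30 h3] := iffLR (@nbhs_CP R _ _) n3.
exists (Num.min e1 (Num.min e2 e3)); first by rewrite !lt_min e10 e20 e30.
move=> [[y1 y2] y3] /=; rewrite !lt_min => /and3P[y1e _ _] /and3P[_ y2e _] /and3P[_ _ y3e].
apply: s; split=> /=; last exact: h3.
by apply: s12; split=> /=; [exact: h1 | exact: h2].
Qed.

(** Over a fixed [v], changing charts only replaces [v] by [v^-1]. The slice can therefore be read
    in whichever chart local pseudoconvexity provides. *)
Lemma chart_img_slice (D : set (Bt R)) (k : bool) (p : Bt R) (x : C3 R) (v z1 z2 : C) :
  chart k p = Some x -> bv p = Some v ->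
  chart_img k D (z1, z2, x.2) <-> chart_img true D (z1, z2, v).
Proof.
case: k => /=; rewrite /chart => + pv; rewrite pv; first by case=> <-.
case: eqP => // /eqP v0 [<-]; split=> -[q Dq] /=; rewrite /chart.
- case qw: (bv q) => [w|].
    by case: eqP => // w0 [<- <- /invr_inj <-]; exists q; rewrite // /chart qw.
  by case=> _ _ /esym/eqP; rewrite invr_eq0 (negbTE v0).
- case qw: (bv q) => [w|] // [<- <- wv]; exists q => //; rewrite /chart qw wv.
  by rewrite (negbTE v0).
Qed.

Lemma chart_z (k : bool) (p : Bt R) (x : C3 R) :
  chart k p = Some x -> x = (bz1 p, bz2 p, x.2).
Proof.
rewrite /chart; case: k; case: (bv p) => [v|] //; first by case=> <-.
- by case: eqP => // _ [<-].
- by case=> <-.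
Qed.

(* Pythagoras: [(- conj p2, conj p1)] is orthogonal to [(p1, p2)] and has the
   same length. *)
Lemma normsq2_tangent (p1 p2 zeta : C) (r s : R) :
  normsq2 (p1 + s%:C%C * (r%:C%C * p1) + zeta * (- (r%:C%C * conjc p2)),
           p2 + s%:C%C * (r%:C%C * p2) + zeta * (r%:C%C * conjc p1)) =
  ((1 + s * r) ^+ 2 + normsq zeta * r ^+ 2) * normsq2 (p1, p2).
Proof.
by case: p1 p2 zeta => [a b] [c d] [e f]; rewrite /normsq2/normsq/=; ring.
Qed.

Lemma expi_normsq (t : R) : normsq (expi t) = 1.
Proof. by rewrite /normsq/= cos2Dsin2. Qed.

Lemma pseudoconvex_fill_shell (D : set (Bt R)) (v : C) :
  Bt_pseudoconvex D ->
  (forall z1 z2, 1 <= normsq2 (z1, z2) <= 4 -> chart_img true D (z1, z2, v)) ->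
  forall z1 z2, 0 < normsq2 (z1, z2) <= 4 -> chart_img true D (z1, z2, v).
Proof.
move=> [oD pD] shell z1 z2 /andP[z0 z4]; apply: contrapT => zD.
(* The missing points at least as far out as [(z1, z2)]: the lower bound keeps this compact set away
   from the origin. *)
pose K : set (C * C) := [set z | normsq2 z <= 4] `&`
  ([set z | normsq2 (z1, z2) <= normsq2 z] `&` [set z | ~ chart_img true D (z.1, z.2, v)]).
have cK : compact K.
  apply: compact_closedI; first exact: compact_normsq2_le.
  apply: closedI; first exact: closed_normsq2_ge.
  apply: (@open_closedC _ [set z : C * C | chart_img true D (z.1, z.2, v)]).
  apply: (@open_comp _ _ (fun z : C * C => (z.1, z.2, v)) _ _ (oD true)).
  move=> z _; move: z; apply: continuous_pair; last exact: cst_continuous.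
  by apply: continuous_pair => z; [exact: cvg_fst | exact: cvg_snd].
have K0 : K !=set0 by exists (z1, z2); split=> //; split=> //=.
have [[p1 p2] /set_mem[/= p4 [/= pz pD']] pmax] :=
  compact_EVT_max K0 cK (continuous_subspaceT continuous_normsq2).
have p_gt0 : 0 < normsq2 (p1, p2) by exact: lt_le_trans pz.
have p_lt1 : normsq2 (p1, p2) < 1.
  rewrite ltNge; apply/negP => p1_; apply: pD'; apply: shell; exact/andP.
have out y1 y2 : normsq2 (p1, p2) < normsq2 (y1, y2) <= 4 -> chart_img true D (y1, y2, v).
  move=> /andP[py y4]; apply: contrapT => yD.
  have : normsq2 (y1, y2) <= normsq2 (p1, p2).
    apply: pmax; apply/mem_set; split=> //; split=> //=.
    exact: ltW (le_lt_trans pz py).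
  by rewrite leNgt py.
have pnz : (p1 != 0) || (p2 != 0) by rewrite -normsq2_gt0.
pose p := @MkBt R p1 p2 (Some v) pnz.
have [k [x [px [V [oV Vx _ pcV]]]]] := pD p.
have slice y1 y2 := @chart_img_slice D k p x v y1 y2 px erefl.
have xE := chart_z px.
have x1 : x.1.1 = p1 by rewrite xE.
have x2 : x.1.2 = p2 by rewrite xE.
suff [_] : (V `&` chart_img k D) x by rewrite xE slice.
have [e e0 eV] := nbhs_C3P (open_nbhs_nbhs (conj oV Vx)).
(* The bound [e / 4] keeps the discs inside [V], and [2^-1] keeps [normsq2] at most 4 on them. *)
pose r := Num.min (2^-1) (e / 4).
have r0 : 0 < r by rewrite lt_min invr_gt0 ltr0n divr_gt0.
have r12 : r <= 2^-1 by rewrite ge_min lexx.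
have re : r <= e / 4 by rewrite ge_min lexx orbT.
(* [d] points radially outward and [b] spans the complex tangent line of the sphere; both vanish in
   the last coordinate, so the discs stay in the slice. *)
pose d : C3 R := (r%:C%C * p1, r%:C%C * p2, 0).
pose b : C3 R := (- (r%:C%C * conjc p2), r%:C%C * conjc p1, 0).
(* One claim for both uses: [s > 0] gives the full discs, [s = 0] with [|zeta| = 1] the limit
   circle. The last condition excludes only the centre of the limit disc, [x] itself. *)
have inG (s : R) (zeta : C) : 0 <= s <= 1 -> normsq zeta <= 1 -> 0 < s + normsq zeta ->
    (V `&` chart_img k D) (c3_line (c3_line x d s%:C%C) b zeta).
  move=> /andP[s0 s1] zeta1 sz; have zeta0 := normsq_ge0 zeta.
  have small (q q' : C) : normsq q + normsq q' < 1 ->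
      normsq (s%:C%C * (r%:C%C * q) + zeta * (r%:C%C * q')) < e.
    move=> qq; apply: le_lt_trans (normsq_add_le _ _) _.
    rewrite !normsqM !normsq_real.
    have A0 : 0 <= r ^+ 2 * normsq q by rewrite mulr_ge0 ?sqr_ge0 ?normsq_ge0.
    have B0 : 0 <= r ^+ 2 * normsq q' by rewrite mulr_ge0 ?sqr_ge0 ?normsq_ge0.
    have A1 : s ^+ 2 * (r ^+ 2 * normsq q) <= r ^+ 2 * normsq q.
      by rewrite ler_piMl// expr_le1.
    have B1 : normsq zeta * (r ^+ 2 * normsq q') <= r ^+ 2 * normsq q'.
      by rewrite ler_piMl.
    have AB : r ^+ 2 * normsq q + r ^+ 2 * normsq q' <= r ^+ 2.
      by rewrite -mulrDr ler_piMr ?sqr_ge0// ltW.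
    have rr : r ^+ 2 <= r by rewrite expr2 ler_piMr ?ltW//; lra.
    lra.
  rewrite xE /c3_line/= !mulr0 !addr0; split.
    apply: eV; rewrite /= ?x1 ?x2.
    - rewrite [X in normsq X](_ : _ = s%:C%C * (r%:C%C * p1) + zeta * (r%:C%C * - conjc p2)).
        by apply: small; rewrite normsqN normsq_conj.
      by ring.
    - rewrite [X in normsq X](_ : _ = s%:C%C * (r%:C%C * p2) + zeta * (r%:C%C * conjc p1)).
        by apply: small; rewrite normsq_conj addrC.
      by ring.
    - by rewrite subrr /normsq/= expr0n addr0.
  rewrite slice; apply: out; rewrite normsq2_tangent.
  have sr0 : 0 <= s * r by rewrite mulr_ge0// ltW.
  have sr1 : s * r <= 2^-1 by nra.
  have sz2 : 0 < (s + normsq zeta) * r ^+ 2 by rewrite mulr_gt0// exprn_gt0.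
  have c1 : 1 < (1 + s * r) ^+ 2 + normsq zeta * r ^+ 2.
    have : s * r ^+ 2 <= s * r by rewrite expr2 mulrA ler_piMr//; lra.
    nra.
  have c4 : (1 + s * r) ^+ 2 + normsq zeta * r ^+ 2 <= 4.
    have : normsq zeta * r ^+ 2 <= 1 by rewrite mulr_ile1 ?sqr_ge0// expr_le1 ?ltW//; lra.
    nra.
  apply/andP; split; first by rewrite ltr_pMl.
  by apply: le_trans c4; rewrite ler_piMr ?ltW//; lra.
apply: pseudoconvex_continuity_principle pcV _ _ => [s /andP[s0 s1] zeta zeta1|t].
- apply: inG; [by rewrite ltW | by rewrite -normc_le1 | ].
  by rewrite ltr_wpDr// normsq_ge0.
- have := inG 0 (expi t); rewrite expi_normsq add0r [c3_line x d _]c3_line0.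
  by apply; rewrite ?lexx ?ler01.
Qed.

End HartogsShell.

(** * The action on the projective line and the quotient map *)

Section Action.
Variable R : realType.
Local Open Scope ring_scope.
Local Notation C := (CC R).

Lemma neq0_natC (n : nat) : n.+1%:R != 0 :> C.
Proof. by rewrite pnatr_eq0. Qed.

(* The coordinate [r = (v + 1) / (v - 1)] sends the fixed points [-1] and [1] of
   [phi] to [0] and infinity, so that [phi] becomes [r |-> 3 r]. *)
Definition linearizer (r : C) : option C :=
  if r == 1 then None else Some ((r + 1) / (r - 1)).

(** The Möbius map [r |-> (r + 1) / (r - 1)] is an involution, so the same formula gives the
    preimage; the value 1 would need [r] infinite. *)
Lemma linearizer_surj (w : option C) : w != Some 1 -> exists r, w = linearizer r.
Proof.
case: w => [v|] v1; last by exists 1; rewrite /linearizer eqxx.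
have {}v1 : v - 1 != 0 by rewrite subr_eq0; apply: contraNneq v1 => ->.
exists ((v + 1) / (v - 1)); rewrite /linearizer; case: eqP => [|_].
  move=> /(congr1 (fun y => y * (v - 1) - (v - 1))); rewrite divfK// mul1r subrr.
  by move=> /eqP; rewrite (_ : _ - _ = 2); [rewrite (negbTE (neq0_natC 1)) | ring].
congr Some; field.
by rewrite v1 (_ : _ + _ = 2) ?(neq0_natC 1)//; ring.
Qed.

Lemma phi_inv_linearizer (r : C) : phi_inv (linearizer r) = linearizer (r / 3).
Proof.
have n2 := neq0_natC 1; have n3 := neq0_natC 2.
rewrite /linearizer (_ : (r / 3 == 1) = (r == 3)); last first.
  by rewrite -subr_eq0 -[RHS]subr_eq0 -(mulIr_eq0 _ (mulIf n3)) mulrBl divfK// mul1r.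
case: eqP => [->|/eqP r1] /=.
  case: eqP => [/eqP|_].
    by rewrite -subr_eq0 (_ : 1 - 3 = - 2); [rewrite oppr_eq0 (negbTE n2) | ring].
  by congr Some; field.
have {}r1 : r - 1 != 0 by rewrite subr_eq0.
have e : 1 - (r + 1) / (r - 1) / 2 = (r - 3) / (2 * (r - 1)) by field.
rewrite e mulf_eq0 invr_eq0 mulf_eq0 (negbTE n2) (negbTE r1) orbF subr_eq0.
case: eqP => // /eqP r3; rewrite -subr_eq0 in r3.
by congr Some; field; rewrite r3 r1.
Qed.

Lemma phi_invK (w : option C) : phi (phi_inv w) = w.
Proof.
have n2 := neq0_natC 1; have n3 := neq0_natC 2.
case: w => [v|] /=.
  case: eqP => [/eqP|/eqP v2] /=.
    rewrite subr_eq0 => /eqP v2; congr Some.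
    by rewrite -[v](divfK n2) -v2 mul1r.
  have v2' : 2 - v != 0.
    apply: contraNneq v2 => v2; apply/eqP.
    rewrite (_ : 1 - v / 2 = (2 - v) / 2); last by field.
    by rewrite v2 mul0r.
  have e : 1 + (v - 2^-1) / (1 - v / 2) / 2 = 3 / (2 * (2 - v)).
    by field.
  rewrite e mulf_eq0 invr_eq0 mulf_eq0 (negbTE n2) (negbTE n3) (negbTE v2') /=.
  by congr Some; field.
by rewrite mulNr divff// subrr eqxx.
Qed.

Lemma phiK (w : option C) : phi_inv (phi w) = w.
Proof.
have n2 := neq0_natC 1; have n3 := neq0_natC 2.
case: w => [v|] /=.
  case: eqP => [/eqP|/eqP v2] /=.
    rewrite addrC addr_eq0 => /eqP v2; congr Some.
    by rewrite -[v](divfK n2) v2 mulN1r.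
  have v2' : 2 + v != 0.
    apply: contraNneq v2 => v2; apply/eqP.
    rewrite (_ : 1 + v / 2 = (2 + v) / 2); last by field.
    by rewrite v2 mul0r.
  have e : 1 - (v + 2^-1) / (1 + v / 2) / 2 = 3 / (2 * (2 + v)).
    by field.
  rewrite e mulf_eq0 invr_eq0 mulf_eq0 (negbTE n2) (negbTE n3) (negbTE v2') /=.
  by congr Some; field.
by rewrite divff// subrr eqxx.
Qed.

Lemma phi_linearizer (r : C) : phi (linearizer r) = linearizer (r * 3).
Proof. by rewrite -[r in LHS](mulfK (neq0_natC 2)) -phi_inv_linearizer phi_invK. Qed.

Lemma iter_phi_inv_linearizer (n : nat) (r : C) :
  iter n (@phi_inv R) (linearizer r) = linearizer (r / 3 ^+ n).
Proof.
elim: n => [|n IHn]; first by rewrite expr0 divr1.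
by rewrite iterS IHn phi_inv_linearizer exprSr invfM mulrA.
Qed.

Lemma halfC : 2^-1 = (2^-1)%:C%C :> C.
Proof. by rewrite fmorphV rmorph_nat. Qed.

(** From [1 - |phi v|^2 = (3/4) (1 - |v|^2) / |1 + v/2|^2]. The positive factor [k] preserves both
    the sign and the vanishing of [1 - |v|^2], which settles the disc and the circle at once. *)
Lemma phi_disc (v : C) : normsq v <= 1 ->
  exists2 v', phi (Some v) = Some v' &
    exists2 k : R, 0 < k & 1 - normsq v' = k * (1 - normsq v).
Proof.
rewrite /phi halfC => v1.
have d0 : 0 < normsq (1 + v * (2^-1)%:C%C).
  by case: v v1 => a b; rewrite /normsq/= => v1; nra.
have d0' : 1 + v * (2^-1)%:C%C != 0 by rewrite -normsq_eq0 gt_eqF.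
rewrite (negbTE d0'); eexists; first reflexivity.
exists (3 / 4 / normsq (1 + v * (2^-1)%:C%C)); first by rewrite !divr_gt0.
rewrite normsq_div//; apply: (mulIf (lt0r_neq0 d0)).
rewrite mulrBl mul1r !divfK ?gt_eqF// mulrAC divfK ?gt_eqF//.
by case: v {v1 d0 d0'} => a b; rewrite /normsq/=; field.
Qed.

Lemma phi_inv_disc (v : C) : normsq v <= 1 ->
  exists2 v', phi_inv (Some v) = Some v' &
    exists2 k : R, 0 < k & 1 - normsq v' = k * (1 - normsq v).
Proof.
rewrite /phi_inv halfC => v1.
have d0 : 0 < normsq (1 - v * (2^-1)%:C%C).
  by case: v v1 => a b; rewrite /normsq/= => v1; nra.
have d0' : 1 - v * (2^-1)%:C%C != 0 by rewrite -normsq_eq0 gt_eqF.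
rewrite (negbTE d0'); eexists; first reflexivity.
exists (3 / 4 / normsq (1 - v * (2^-1)%:C%C)); first by rewrite !divr_gt0.
rewrite normsq_div//; apply: (mulIf (lt0r_neq0 d0)).
rewrite mulrBl mul1r !divfK ?gt_eqF// mulrAC divfK ?gt_eqF//.
by case: v {v1 d0 d0'} => a b; rewrite /normsq/=; field.
Qed.

Lemma Bt_eq (p q : Bt R) :
  bz1 p = bz1 q -> bz2 p = bz2 q -> bv p = bv q -> p = q.
Proof.
case: p q => [a b c h] [a' b' c' h'] /= ea eb ec.
by subst; congr MkBt; exact: bool_irrelevance.
Qed.

Lemma B_eq (b c : B R) : sval b = sval c -> b = c.
Proof.
case: b c => [S hS] [S' hS'] /= e; subst; congr exist; exact: Prop_irrelevance.
Qed.

Lemma tpi_surj (b : B R) : exists p, b = tpi p.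
Proof. by case: b => S [p pS]; exists p; apply: B_eq. Qed.

Lemma half_neq0 (z1 z2 : C) :
  (z1 != 0) || (z2 != 0) -> (z1 / 2 != 0) || (z2 / 2 != 0).
Proof. by rewrite !mulf_eq0 !invr_eq0 (negbTE (neq0_natC 1)) !orbF. Qed.

(* The action of [-1]. *)
Definition deck (p : Bt R) : Bt R :=
  @MkBt R (bz1 p / 2) (bz2 p / 2) (phi_inv (bv p)) (half_neq0 (bnz p)).

Lemma iter_deck (n : nat) (p : Bt R) :
  [/\ bz1 (iter n deck p) = bz1 p / 2 ^+ n,
      bz2 (iter n deck p) = bz2 p / 2 ^+ n &
      bv (iter n deck p) = iter n (@phi_inv R) (bv p)].
Proof.
elim: n => [|n [IH1 IH2 IH3]]; first by rewrite expr0 !divr1.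
by rewrite !iterS /= IH1 IH2 IH3 !exprSr !invfM !mulrA.
Qed.

Lemma phin_phi_inv (n : int) (w : option C) : phin n (phi_inv w) = phin (n - 1) w.
Proof.
case: n => [[|m]|m] //.
- by rewrite subzSS subr0 /phin iterSr phi_invK.
- by rewrite /phin -iterSr NegzE -opprD -PoszD addn1.
Qed.

Lemma tpi_deck (p : Bt R) : tpi (deck p) = tpi p.
Proof.
have n2 := neq0_natC 1.
have e2 (n : int) : (2 : C) ^ (n - 1) = 2 ^ n / 2 by rewrite expfzDr.
apply: B_eq; apply/seteqP; split=> q [n [/= q1 q2 qv]].
- exists (n - 1); rewrite e2 q1 q2 qv phin_phi_inv.
  by split=> //; rewrite mulrA mulrAC.
- exists (n + 1); rewrite /= phin_phi_inv addrK; split=> //.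
  + by rewrite q1 expfzDr// expr1z -mulrA [2 * _]mulrC divfK.
  + by rewrite q2 expfzDr// expr1z -mulrA [2 * _]mulrC divfK.
Qed.

Lemma tpi_iter_deck (n : nat) (p : Bt R) : tpi (iter n deck p) = tpi p.
Proof. by elim: n => // n IHn; rewrite iterS tpi_deck. Qed.

Lemma iter_phiK (n : nat) (w : option C) :
  iter n (@phi_inv R) (iter n (@phi R) w) = w.
Proof. by elim: n w => // n IHn w; rewrite iterSr iterS phiK IHn. Qed.

(** An integer translation is a natural power of [deck] applied to one of the two points, so
    invariance has to be checked for [deck] alone. *)
Lemma tpi_eqP (p q : Bt R) : tpi p = tpi q ->
  exists n, p = iter n deck q \/ q = iter n deck p.
Proof.
move=> /(congr1 sval) /= pq.
have : orbitZ p q by rewrite pq; exists 0; rewrite !mul1r.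
case=> -[m|m] [q1 q2 qv].
- exists m; left; have [s1 s2 sv] := iter_deck m q.
  have n2m : (2 : C) ^+ m != 0 by rewrite expf_neq0 ?neq0_natC.
  by apply: Bt_eq; rewrite ?s1 ?s2 ?sv ?q1 ?q2 ?qv ?iter_phiK// mulrC mulKf.
- exists m.+1; right; have [s1 s2 sv] := iter_deck m.+1 p.
  by apply: Bt_eq; rewrite ?s1 ?s2 ?sv ?q1 ?q2 ?qv// mulrC.
Qed.

Lemma deck_invariant (S : set (Bt R)) (p q : Bt R) :
  (forall p, S p <-> S (deck p)) -> tpi p = tpi q -> S p -> S q.
Proof.
move=> Sinv.
have Siter n x : S x <-> S (iter n deck x).
  by elim: n => // n IHn; rewrite iterS -Sinv.
by move=> /tpi_eqP[n [->|->]]; rewrite -Siter.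
Qed.

(** Membership in an image only yields some representative; invariance of the disc transfers the
    condition to every other one. *)
Lemma Omega_tpi (p : Bt R) :
  Omega (tpi p) <-> exists2 v, bv p = Some v & normsq v < 1.
Proof.
split=> [[q [v qv v1] qp]|[v pv v1]]; last by exists p => //; exists v; rewrite ?normc_lt1.
apply: (@deck_invariant [set p | exists2 v, bv p = Some v & normsq v < 1] q p _ qp);
  last by exists v; rewrite -?normc_lt1.
move=> {qp}p; split=> -[w pw w1].
- have [w' ww' [k k0 kw]] := phi_inv_disc (ltW w1).
  exists w'; first by rewrite /= pw.
  by rewrite -subr_gt0 kw mulr_gt0// subr_gt0.
- have [w' ww' [k k0 kw]] := phi_disc (ltW w1).
  exists w'; first by rewrite -[bv p]phi_invK -[phi_inv _]/(bv (deck p)) pw.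
  by rewrite -subr_gt0 kw mulr_gt0// subr_gt0.
Qed.

Lemma circle_part_tpi (p : Bt R) :
  circle_part (tpi p) <-> exists2 v, bv p = Some v & normsq v = 1.
Proof.
split=> [[q [v qv /eqP v1] qp]|[v pv v1]]; last first.
  by exists p => //; exists v => //; apply/eqP; rewrite normc_eq1 v1.
rewrite normc_eq1 in v1.
apply: (@deck_invariant [set p | exists2 v, bv p = Some v & normsq v = 1] q p _ qp);
  last by exists v => //; exact/eqP.
move=> {qp}p; split=> -[w pw w1].
- have [|w' ww' [k k0]] := @phi_inv_disc w; first by rewrite w1.
  rewrite w1 subrr mulr0 => /eqP; rewrite subr_eq0 => /eqP w1'.
  by exists w'; rewrite //= pw.
- have [|w' ww' [k k0]] := @phi_disc w; first by rewrite w1.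
  rewrite w1 subrr mulr0 => /eqP; rewrite subr_eq0 => /eqP w1'.
  by exists w' => //; rewrite -[bv p]phi_invK -[phi_inv _]/(bv (deck p)) pw.
Qed.

End Action.

(** * The closure of [Omega] and an invariant graph disjoint from it *)

Section ClosureAndNeighborhoods.
Variable R : realType.
Local Open Scope ring_scope.
Local Notation C := (CC R).

(** Inverse of the last coordinate of [chart k]. *)
Definition P1_of_chart (k : bool) (c : C) : option C :=
  if k then Some c else if c == 0 then None else Some c^-1.

Lemma chart_imgP (k : bool) (S : set (Bt R)) (z1 z2 c : C) :
  chart_img k S (z1, z2, c) <-> exists h, S (@MkBt R z1 z2 (P1_of_chart k c) h).
Proof.
split=> [[[y1 y2 w h] Sp]|[h Sp]].
- rewrite /chart/=; case: k; case: w Sp => [v|] Sp //.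
  + by case=> <- <- <-; exists h.
  + case: eqP => // /eqP v0 [<- <- <-]; exists h.
    by rewrite /P1_of_chart invr_eq0 (negbTE v0) invrK.
  + by case=> <- <- <-; exists h; rewrite /P1_of_chart eqxx.
- exists (@MkBt R z1 z2 (P1_of_chart k c) h) => //.
  rewrite /chart/P1_of_chart/=; case: k {Sp} => //.
  by case: eqP => [->|/eqP c0] //; rewrite invr_eq0 (negbTE c0) invrK.
Qed.

(** The condition [0 < normsq2] replaces the nonvanishing proof stored in [Bt], so openness is
    tested in [C3]. *)
Lemma Bt_open_pred (Q : C * C -> option C -> Prop) :
  (forall k, open [set x : C3 R | 0 < normsq2 x.1 /\ Q x.1 (P1_of_chart k x.2)]) ->
  Bt_open [set p | Q (bz1 p, bz2 p) (bv p)].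
Proof.
move=> oQ k; congr (open _): (oQ k); apply/seteqP; split=> -[[z1 z2] c] /=.
- rewrite normsq2_gt0 => -[h Qz].
  by apply/chart_imgP; exists h.
- by move=> /chart_imgP[h Qz]; rewrite normsq2_gt0.
Qed.

Lemma open_C2star : open [set x : C3 R | 0 < normsq2 x.1].
Proof.
have c : continuous (fun x : C3 R => normsq2 x.1).
  move=> x; apply: (@continuous_comp _ _ _ fst (@normsq2 R)); first exact: continuous_fst.
  exact: continuous_normsq2.
exact: (open_preimage c (@open_gt R 0)).
Qed.

Lemma continuous_normsq_snd : continuous (fun x : C3 R => normsq x.2).
Proof.
move=> x; apply: (@continuous_comp _ _ _ snd (@normsq R)); first exact: continuous_snd.
exact: continuous_normsq.
Qed.

Lemma B_closure_Omega : B_closure (@Omega R) = @Omega R `|` @circle_part R.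
Proof.
apply/seteqP; split=> b.
- move=> clb; apply: contrapT => bN.
  have [] := clb (~` (@Omega R `|` @circle_part R)) _ bN; last first.
    by move=> c cN cO; apply: cN; left.
  pose Q (z : C * C) (w : option C) : Prop := ~ exists2 v, w = Some v & normsq v <= 1.
  rewrite /B_open (_ : _ @^-1` _ = [set p | Q (bz1 p, bz2 p) (bv p)]); last first.
    apply/seteqP; split=> p /= pN.
    - move=> [v pv]; rewrite le_eqVlt => /orP[/eqP v1|v1]; apply: pN.
        by right; apply/circle_part_tpi; exists v.
      by left; apply/Omega_tpi; exists v.
    - case=> [/Omega_tpi|/circle_part_tpi] [v pv v1]; apply: pN; exists v => //.
        exact: ltW.
      by rewrite v1.
  apply: Bt_open_pred => -[].
  + rewrite (_ : [set _ | _] = [set x | 0 < normsq2 x.1] `&` [set x | 1 < normsq x.2]).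
      apply: openI; first exact: open_C2star.
      exact: (open_preimage continuous_normsq_snd (@open_gt R 1)).
    apply/seteqP; split=> x [x0 xQ]; split=> //=.
      by rewrite ltNge; apply/negP => x1; apply: xQ; exists x.2.
    by move=> [_ [<-]]; rewrite leNgt xQ.
  (* In the chart at infinity the exterior of the closed disc is [|c| < 1], where [c = 0] is the
     point at infinity. *)
  + rewrite (_ : [set _ | _] = [set x | 0 < normsq2 x.1] `&` [set x | normsq x.2 < 1]).
      apply: openI; first exact: open_C2star.
      exact: (open_preimage continuous_normsq_snd (@open_lt R 1)).
    apply/seteqP; split=> x [x0 xQ]; split=> //=.
      rewrite ltNge; apply/negP => x1; apply: xQ; rewrite /P1_of_chart.
      have n0 : x.2 != 0 by rewrite -normsq_eq0 gt_eqF// (lt_le_trans _ x1).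
      rewrite (negbTE n0); exists (x.2)^-1 => //.
      by rewrite normsqV// invf_le1// (lt_le_trans _ x1).
    rewrite /Q/P1_of_chart => -[v]; case: eqP => // /eqP n0 [<-].
    by rewrite normsqV// leNgt invf_gt1 ?xQ// lt_def normsq_eq0 n0 normsq_ge0.
- case: (tpi_surj b) => p -> [pO U _ Up|/circle_part_tpi[v pv v1] U oU Up].
    by exists (tpi p).
  have pimg : chart_img true (@tpi R @^-1` U) (bz1 p, bz2 p, v).
    by exists p => //; rewrite /chart pv.
  have [e e0 eU] := nbhs_C3P (open_nbhs_nbhs (conj (oU true) pimg)).
  (* A point [v] of the circle is approached radially by [(1 - d) v]; the squared distance [d^2] is
     at most [e / 4]. *)
  pose d := Num.min (2^-1) (e / 2).
  have d0 : 0 < d by rewrite lt_min invr_gt0 ltr0n divr_gt0.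
  have d12 : d <= 2^-1 by rewrite ge_min lexx.
  have de : d <= e / 2 by rewrite ge_min lexx orbT.
  have [|||q Uq qE] := eU (bz1 p, bz2 p, (1 - d)%:C%C * v) => /=.
  + by rewrite subrr normsq_real expr0n.
  + by rewrite subrr normsq_real expr0n.
  + rewrite (_ : _ - _ = (- d)%:C%C * v); last by rewrite !(rmorphB, rmorphN, rmorph1); ring.
    by rewrite normsqM normsq_real v1; nra.
  exists (tpi q) => //; apply/Omega_tpi; exists ((1 - d)%:C%C * v).
    by move: qE; rewrite /chart; case: (bv q) => // ? [_ _ ->].
  by rewrite normsqM normsq_real v1; nra.
Qed.

(* [growth (2 z) = 3 growth z], matching the multiplier of [phi]; the graph
   [v = linearizer (growth z)] is therefore invariant, and it lies outside the
   closed disc bundle. *)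
Definition growth (z : C * C) : R := expR (ln 3 / ln 4 * ln (normsq2 z)).

Lemma growth_half (z1 z2 : C) : (z1 != 0) || (z2 != 0) ->
  growth (z1 / 2, z2 / 2) = growth (z1, z2) / 3.
Proof.
rewrite -normsq2_gt0 /growth => z0.
have -> : normsq2 (z1 / 2, z2 / 2) = normsq2 (z1, z2) / 4.
  by rewrite /normsq2/= halfC !normsqM normsq_real; field.
rewrite ln_div ?posrE// mulrBr divfK; last first.
  by rewrite gt_eqF// ln_gt0// ltr1n.
by rewrite expRB lnK ?posrE.
Qed.

Lemma growth_gt0 z : 0 < growth z.
Proof. exact: expR_gt0. Qed.

Lemma continuous_growth z : 0 < normsq2 z -> {for z, continuous growth}.
Proof.
move=> z0.
have cl : {for z, continuous (fun y : C * C => ln (normsq2 y))}.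
  apply: (@continuous_comp _ _ _ (@normsq2 R) (@ln R)); last exact: continuous_ln.
  exact: continuous_normsq2.
have cm : {for z, continuous (fun y : C * C => ln 3 / ln 4 * ln (normsq2 y))}.
  exact: (cvgM (cvg_cst (ln 3 / ln 4)) cl).
exact: (continuous_comp cm (@continuous_expR R _)).
Qed.

(** Here [F] stands for the equation of the graph in a chart; continuity of [growth] is available
    only where [normsq2] is positive. *)
Lemma open_growth_neq0 (F : C3 R * R -> C) : continuous F ->
  open [set x : C3 R | 0 < normsq2 x.1 /\ F (x, growth x.1) <> 0].
Proof.
move=> cF; rewrite openE => x [x0 Fx]; apply: filterI.
  exact: (open_nbhs_nbhs (conj open_C2star x0)).
have cg : {for x, continuous (fun y : C3 R => growth y.1)}.
  apply: (@continuous_comp _ _ _ fst growth); first exact: continuous_fst.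
  exact: continuous_growth.
have c : {for x, continuous (fun y : C3 R => normsq (F (y, growth y.1)))}.
  apply: (@continuous_comp _ _ _ (fun y : C3 R => F (y, growth y.1)) (@normsq R)).
    apply: (@continuous_comp _ _ _ (fun y : C3 R => (y, growth y.1)) F); last exact: cF.
    exact: (cvg_pair cvg_id cg).
  exact: continuous_normsq.
have : nbhs (normsq (F (x, growth x.1))) [set r | 0 < r].
  apply: open_nbhs_nbhs; split; first exact: open_gt.
  by rewrite /= lt_def normsq_ge0 andbT normsq_eq0; exact/eqP.
move=> /c h; apply: (@filterS _ (nbhs x) _ _ _ _ h) => y /=.
by rewrite lt_def normsq_eq0 => /andP[/eqP].
Qed.

(** The test neighborhood: open, containing the closure of [Omega], yet not all of [B]. *)
Definition off_graph : set (B R) :=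
  ~` (@tpi R @` [set p | bv p = linearizer (growth (bz1 p, bz2 p))%:C%C]).

Lemma off_graph_tpi (p : Bt R) :
  off_graph (tpi p) <-> bv p <> linearizer (growth (bz1 p, bz2 p))%:C%C.
Proof.
split=> [pN pE|pN [q qE qp]]; first by apply: pN; exists p.
apply: pN; move: qE.
apply: (@deck_invariant R [set p | bv p = linearizer (growth (bz1 p, bz2 p))%:C%C] q p _ qp).
move=> {qp}p /=.
have -> : (growth (bz1 p / 2, bz2 p / 2))%:C%C = (growth (bz1 p, bz2 p))%:C%C / 3 :> C.
  by rewrite growth_half ?bnz// fmorph_div rmorph_nat.
split=> [->|/(congr1 (@phi R))]; first by rewrite phi_inv_linearizer.
by rewrite phi_invK phi_linearizer divfK// neq0_natC.
Qed.

(** Clearing denominators gives [c (r - 1) = r + 1] in the finite chart and [c (r + 1) = r - 1] at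
    infinity; the powers of -1 merge both into one equation, continuous in [c] and [r]. *)
Lemma P1_of_chart_linearizer (k : bool) (c r : C) : r + 1 != 0 ->
  P1_of_chart k c = linearizer r <->
  c * (r + (-1) ^+ k) + (-1) * (r + (-1) ^+ (~~ k)) = 0.
Proof.
move=> r1; have n2 := @neq0_natC R 1; rewrite mulN1r /linearizer /P1_of_chart.
case: k => /=; rewrite expr0 expr1.
- case: eqP => [->|/eqP r1']; split=> //.
  + by move=> /eqP; rewrite subrr mulr0 sub0r oppr_eq0 (negbTE n2).
  + by move=> [->]; rewrite divfK ?subrr// subr_eq0.
  + by move=> /eqP; rewrite subr_eq0 => /eqP <-; rewrite mulfK// subr_eq0.
- case: (eqVneq c 0) => [->|c0]; case: eqP => [->|/eqP r1']; split=> //.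
  + by rewrite mul0r subrr subr0.
  + by move=> /eqP; rewrite mul0r sub0r oppr_eq0 subr_eq0 (negbTE r1').
  + by move=> /eqP; rewrite subrr subr0 mulf_eq0 (negbTE c0) (negbTE n2).
  + move=> [/(congr1 GRing.inv)]; rewrite invrK => ->.
    by rewrite invf_div divfK// subrr.
  + by move=> /eqP; rewrite subr_eq0 => /eqP <-; rewrite invfM mulrCA divff// mulr1.
Qed.

Lemma B_open_off_graph : B_open off_graph.
Proof.
pose Q (z : C * C) (w : option C) := w <> linearizer (growth z)%:C%C.
rewrite /B_open (_ : _ @^-1` _ = [set p | Q (bz1 p, bz2 p) (bv p)]); last first.
  by apply/seteqP; split=> p /off_graph_tpi.
have cC : continuous (fun y : C3 R * R => y.1.2 : C).
  move=> y; apply: (@continuous_comp _ _ _ fst snd); first exact: continuous_fst.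
  exact: continuous_snd.
have cR (a : R) : continuous (fun y : C3 R * R => (y.2 + a)%:C%C : C).
  apply: continuous_Complex_fun; last exact: cst_continuous.
  by move=> y; apply: cvgD; [exact: cvg_snd | exact: cvg_cst].
apply: Bt_open_pred => k.
pose F (y : C3 R * R) : C :=
  y.1.2 * (y.2 + (-1) ^+ k)%:C%C + (-1) * (y.2 + (-1) ^+ (~~ k))%:C%C.
have cF : continuous F.
  have cN1 : continuous (fun _ : C3 R * R => -1 : C) by exact: cst_continuous.
  exact: (continuous_addC_fun (continuous_mulC_fun cC (cR ((-1) ^+ k)))
    (continuous_mulC_fun cN1 (cR ((-1) ^+ (~~ k))))).
congr (open _): (open_growth_neq0 cF).
have FP (x : C3 R) :
    F (x, growth x.1) = 0 <-> P1_of_chart k x.2 = linearizer (growth x.1)%:C%C.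
  rewrite P1_of_chart_linearizer.
    by rewrite /F/= !rmorphD/= !rmorph_sign.
  by rewrite -(rmorph1 (real_complex R)) -rmorphD fmorph_eq0 gt_eqF// addr_gt0// growth_gt0.
by apply/seteqP; split=> x [x0 xE]; split=> // /FP.
Qed.

(** For real [g > 0] one has [|g + 1| > |g - 1|], so [linearizer g] lies outside the closed disc. *)
Lemma closure_sub_off_graph : B_closure (@Omega R) `<=` off_graph.
Proof.
rewrite B_closure_Omega => b; case: (tpi_surj b) => p -> H.
have [v pv v1] : exists2 v, bv p = Some v & normsq v <= 1.
  case: H => [/Omega_tpi|/circle_part_tpi] [v pv v1]; exists v => //; last by rewrite v1.
  exact: ltW.
apply/off_graph_tpi; rewrite pv /linearizer; set g := growth _.
have g0 : 0 < g := growth_gt0 _.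
case: eqP => // /eqP g1 [vE]; move: v1; apply/negP; rewrite -ltNge vE.
have {}g1 : g%:C%C - 1 != 0 by rewrite subr_eq0.
rewrite normsq_div// ltr_pdivlMr.
  by rewrite mul1r /normsq/=; nra.
by rewrite lt_def normsq_eq0 g1 normsq_ge0.
Qed.

Lemma off_graph_neqT : off_graph <> setT.
Proof.
have h : ((1 : C) != 0) || ((0 : C) != 0) by rewrite oner_eq0.
move=> /seteqP[_ /(_ (tpi (@MkBt R 1 0 (linearizer (growth (1, 0))%:C%C) h)))].
by move=> /(_ I) /off_graph_tpi.
Qed.

(** * Pseudoconvex neighborhoods of the closure *)

Lemma linearizer_near (e : R) : 0 < e -> exists2 d : R, 0 < d &
  forall r, normsq r < d -> exists2 v, linearizer r = Some v & normsq (v + 1) < e.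
Proof.
(* [linearizer r + 1 = 2 r / (r - 1)]; since [|r|^2 < 1/4] gives [|r - 1|^2 >= 1/4], its squared
   modulus is at most [16 |r|^2]. *)
move=> e0; exists (Num.min (4^-1) (e / 16)); first by rewrite lt_min invr_gt0 ltr0n divr_gt0.
move=> r; rewrite lt_min => /andP[r4 re].
have r1 : 4^-1 <= normsq (r - 1).
  by case: r r4 {re} => a b; rewrite /normsq/=; nra.
have r10 : r - 1 != 0 by rewrite -normsq_eq0 gt_eqF// (lt_le_trans _ r1).
rewrite /linearizer -[r == 1]subr_eq0 (negbTE r10); eexists; first reflexivity.
rewrite (_ : _ + 1 = 2%:C%C * r / (r - 1)); last by rewrite rmorph_nat; field.
rewrite normsq_div// normsqM normsq_real ltr_pdivrMr; first by nra.
by rewrite lt_def normsq_eq0 r10 normsq_ge0.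
Qed.

Lemma exp4_large (X : R) : exists n : nat, X < 4 ^+ n.
Proof.
exists (Num.bound `|X|); apply: le_lt_trans (ler_norm X) _.
apply: lt_le_trans (archi_boundP (normr_ge0 _)) _.
by rewrite -natrX ler_nat ltnW// ltn_expl.
Qed.

Lemma pseudoconvex_nbhd_full (W : set (B R)) :
  B_pseudoconvex W -> B_closure (@Omega R) `<=` W -> W = setT.
Proof.
rewrite B_closure_Omega => pW clW; apply/seteqP; split=> // b _.
case: (tpi_surj b) => p ->; apply: contrapT => pN.
set D := @tpi R @^-1` W in pW *.
have discD q v : bv q = Some v -> normsq v <= 1 -> D q.
  move=> qv; rewrite le_eqVlt => /orP[/eqP v1|v1]; apply: clW.
    by right; apply/circle_part_tpi; exists v.
  by left; apply/Omega_tpi; exists v.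
have oD := pW.1 true.
(* Only [v = 1] has no coordinate [r], and it lies in the closed disc, hence over it [D] is full. *)
have [r pr] : exists r, bv p = linearizer r.
  apply: linearizer_surj; apply/eqP => p1; apply: pN.
  by apply: (discD p 1); rewrite // normsq_real expr1n.
(* [D] contains the shell over [-1], a point of the circle; compactness of the shell spreads this to
   all nearby [v]. *)
have shell : \forall v \near (-1 : C),
    [set z | normsq2 z <= 4] `&` [set z | 1 <= normsq2 z] `<=`
    [set z : C * C | chart_img true D (z.1, z.2, v)].
  have cK := compact_closedI (@compact_normsq2_le R 4) (@closed_normsq2_ge R 1).
  apply: (iffLR (compact_near_coveringP _) cK C (nbhs (-1 : C))
    (fun v z => chart_img true D (z.1, z.2, v))) => -[z1 z2] [_ /= z0].
  have zD : chart_img true D (z1, z2, -1).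
    have h : (z1 != 0) || (z2 != 0) by rewrite -normsq2_gt0 (lt_le_trans _ z0).
    apply/chart_imgP; exists h; apply: (discD _ (-1)) => //.
    by rewrite normsqN normsq_real expr1n.
  by apply: filterS (open_nbhs_nbhs (conj oD zD)) => -[[y1 y2] y3].
have [e e0 eshell] := iffLR (@nbhs_CP R _ _) shell.
have [d d0 dlin] := linearizer_near e0.
(* One [n] serves both factors: [z] is divided by [2^n], with [|2^n|^2 = 4^n], and [r] by [3^n],
   with [|3^n|^2 = 9^n >= 4^n]. *)
have [n nX] := exp4_large (Num.max (normsq r / d) (normsq2 (bz1 p, bz2 p))).
move: nX; rewrite gt_max => /andP[nr np].
have [v rv ve] : exists2 v, linearizer (r / 3 ^+ n) = Some v & normsq (v + 1) < e.
  apply: dlin; rewrite normsq_div ?expf_neq0 ?neq0_natC//.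
  have -> : (3 : C) ^+ n = (3 ^+ n)%:C%C by rewrite rmorphXn/= rmorph_nat.
  rewrite normsq_real ltr_pdivrMr ?exprn_gt0//.
  rewrite ltr_pdivrMr// in nr; apply: lt_le_trans nr _.
  rewrite mulrC ler_pM2l// -exprM mulnC exprM.
  by rewrite lerXn2r ?nnegrE//; lra.
have [s1 s2 sv] := iter_deck n p.
have h : 0 < normsq2 (bz1 (iter n (@deck R) p), bz2 (iter n (@deck R) p)) <= 4.
  rewrite normsq2_gt0 bnz s1 s2 /=.
  have n2 : (2 : C) ^+ n != 0 by rewrite expf_neq0 ?neq0_natC.
  rewrite /normsq2/= !normsq_div// -mulrDl.
  have -> : normsq ((2 : C) ^+ n) = 4 ^+ n.
    have -> : (2 : C) ^+ n = (2 ^+ n)%:C%C by rewrite rmorphXn/= rmorph_nat.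
    by rewrite normsq_real -exprM mulnC exprM expr2 -natrM.
  rewrite ler_pdivrMr ?exprn_gt0//; apply: le_trans (ltW np) _.
  by rewrite ler_peMl// ?exprn_ge0// ler1n.
have [|q Dq qE] := pseudoconvex_fill_shell pW _ h (v := v).
  have ev : normsq (v - -1) < e by rewrite opprK.
  by move=> z1 z2 /andP[z0 z4]; exact: (eshell v ev (z1, z2) (conj z4 z0)).
apply: pN; rewrite -[tpi p](tpi_iter_deck n); suff -> : iter n (@deck R) p = q by [].
move: qE; rewrite /chart; case qw: (bv q) => [w|] // [q1 q2 wv].
by apply: Bt_eq; rewrite // qw wv sv pr iter_phi_inv_linearizer rv.
Qed.

End ClosureAndNeighborhoods.

Theorem theorem3p2 (R : realType) :
  B_closure (@Omega R) = @Omega R `|` @circle_part R /\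
  ~ (exists F : set (set (@B R)),
       (forall W, F W -> [/\ B_open W, B_pseudoconvex W & B_closure (@Omega R) `<=` W]) /\
       (forall U, B_open U -> B_closure (@Omega R) `<=` U -> exists2 W, F W & W `<=` U)) /\
  ~ (exists Om : nat -> set (@B R),
       [/\ forall n, B_domain (Om n) /\ B_pseudoconvex (Om n),
           forall n, Om n.+1 `<=` Om n &
           \bigcap_n Om n = B_closure (@Omega R)]).
Proof.
split; [exact: B_closure_Omega | split].
- move=> [F [FP Fbasis]].
  (* A basis member inside [off_graph] would be all of [B]. *)
  have [W /FP[_ pW clW] WU] := Fbasis _ (@B_open_off_graph R) (@closure_sub_off_graph R).
  apply: (@off_graph_neqT R); apply/seteqP; split=> // b _; apply: WU.
  by rewrite (pseudoconvex_nbhd_full pW clW).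
- move=> [Om [OmP _ Omcap]].
  (* Every [Om n] is all of [B], so the closure would be too, although it misses the graph. *)
  apply: (@off_graph_neqT R); apply/seteqP; split=> // b _.
  apply: closure_sub_off_graph; rewrite -Omcap => n _.
  rewrite (pseudoconvex_nbhd_full (OmP n).2)// -Omcap.
  exact: bigcap_inf.
Qed.
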